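(* For $\pi\in\mathfrak S_n$ and $0\le t\le n$, let $\pi^{(t)}=\pi_1\cdots\pi_t\,(n+1)\,\pi_{t+1}\cdots\pi_n\in\mathfrak S_{n+1}$. Then $$b(\pi^{(t)})=b(\pi)+\operatorname{rlmax}(\pi_1\cdots\pi_t).$$ Consequently, $$D_{n+1}(q)=\sum_{\pi\in\mathfrak S_n}q^{b(\pi)}\sum_{t=0}^n q^{\operatorname{rlmax}(\pi_1\cdots\pi_t)}.$$
   Context: $\mathfrak S_n$ is the set of permutations $\pi=\pi_1\cdots\pi_n$ of $\{1,\dots,n\}$ ($\mathfrak S_0$ consists of the empty permutation $\varepsilon$). An occurrence of the boxed pattern $\mathrm{Box}(12)$ in $\pi$ is a pair of positions $i<j$ with $\pi_i<\pi_j$ such that no $k$ with $i<k<j$ satisfies $\pi_i<\pi_k<\pi_j$; $b(\pi)$ is the number of such occurrences, and $D_n(q)=\sum_{\pi\in\mathfrak S_n}q^{b(\pi)}$. For a word $w=w_1\cdots w_t$ with distinct entries, $\operatorname{rlmax}(w)=|\{i\in\{1,\dots,t\}: w_i>w_j\text{ for every } i<j\le t\}|$ is its number of right-to-left maxima, with $\operatorname{rlmax}(\varepsilon)=0$. *)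

(* Defs.v *)
From mathcomp Require Import all_boot all_order all_algebra all_fingroup.
Set Implicit Arguments.
Unset Strict Implicit.
Unset Printing Implicit Defensive.
Import GRing.Theory.

Local Open Scope nat_scope.

(* A permutation of {1, ..., n} is encoded as pi : 'S_n, with positions and
   values both shifted down by 1; word pi undoes the shift on values and is the
   one-line notation pi_1 ... pi_n. *)
Definition word (n : nat) (pi : 'S_n) : seq nat :=
  [seq (pi i).+1 | i <- enum 'I_n].

Definition box12_occ (n : nat) (pi : 'S_n) (i j : 'I_n) : bool :=
  [&& i < j, pi i < pi j &
      ~~ [exists k : 'I_n, (i < k < j) && (pi i < pi k < pi j)]].

Definition b (n : nat) (pi : 'S_n) : nat :=
  #|[set ij : 'I_n * 'I_n | box12_occ pi ij.1 ij.2]|.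

Definition D (n : nat) : {poly int} := (\sum_(pi : 'S_n) 'X^(b pi))%R.

Definition rlmax (w : seq nat) : nat :=
  #|[set i : 'I_(size w) |
      [forall j : 'I_(size w), (i < j) ==> (nth 0 w j < nth 0 w i)]]|.

(* In 0-based terms the new maximum of 'S_n.+1 is ord_max, and inserting it
   after the first t letters puts it at position t; see word_insert_max. *)
Definition insert_max (n : nat) (t : 'I_n.+1) (pi : 'S_n) : 'S_n.+1 :=
  lift_perm t ord_max pi.

Lemma nth_word (n : nat) (pi : 'S_n) (i : 'I_n) : nth 0 (word pi) i = (pi i).+1.
Proof. by rewrite (nth_map i) ?size_enum_ord // nth_ord_enum. Qed.

Lemma size_word (n : nat) (pi : 'S_n) : size (word pi) = n.
Proof. by rewrite size_map size_enum_ord. Qed.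

Lemma word_insert_max (n : nat) (t : 'I_n.+1) (pi : 'S_n) :
  word (insert_max t pi) = take t (word pi) ++ n.+1 :: drop t (word pi).
Proof.
have tn : t <= n by rewrite -ltnS.
have st : size (take t (word pi)) = t by rewrite size_takel // size_word.
apply: (@eq_from_nth _ 0).
  by rewrite size_cat /= size_drop st !size_word addnS subnKC.
move=> i; rewrite size_word => ltin.
rewrite (nth_word _ (Ordinal ltin)) nth_cat st.
case: (unliftP t (Ordinal ltin)) => [j|] e; rewrite e.
  rewrite lift_perm_lift lift_max.
  have -> : i = bump t j by rewrite -[i]/(val (Ordinal ltin)) e.
  rewrite /bump; case: (leqP t j) => tj /=.
    by rewrite add1n ltnNge leqW //= subSn //= nth_drop subnKC // nth_word.
  by rewrite add0n tj nth_take // nth_word.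
rewrite lift_perm_id -[i]/(val (Ordinal ltin)) e /=.
by rewrite ltnn subnn.
Qed.

(* Main.v *)
Require Import Defs.
From mathcomp Require Import all_boot all_order all_algebra all_fingroup.
Import GRing.Theory.
Local Open Scope ring_scope.

(** Write [s] for the permutation obtained from [pi] by inserting a new maximum
    at position [t], and sort the pairs of positions of [s] according to whether
    they use [t].
    - A pair avoiding [t] is a pair of positions of [pi].  The new letter exceeds
      every other one, so it never lies in the open box spanned by such a pair:
      being an occurrence is unaffected ([box12_occ_lift_lift]), and these pairs
      contribute [b pi].
    - The new letter cannot be the smaller entry of an occurrence
      ([box12_occ_max_l]).
    - When the new letter is the larger entry, the box is unbounded above, so
      emptiness of the box says that the other entry dominates all the letters
      between it and position [t], i.e. is a right-to-left maximum of the prefix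
      of length [t] ([box12_occ_lift_max], [rlmax_take_word]).
    The formula for [D n.+1] follows because every permutation in ['S_n.+1]
    arises from exactly one pair [(t, pi)]: [t] is the position of its maximum
    ([insert_max_bij]). *)

(** As a double sum, [b] splits along [bigD1_ord] into the new position and the
    old ones, in each coordinate separately. *)
Lemma b_sum (n : nat) (pi : 'S_n) :
  b pi = (\sum_i \sum_j box12_occ pi i j)%N.
Proof.
rewrite /b -sum1dep_card pair_bigA /= big_mkcond /=.
by apply: eq_bigr => ij _; case: box12_occ.
Qed.

Lemma ltn_lift (n : nat) (t : 'I_n.+1) (i j : 'I_n) :
  (lift t i < lift t j)%N = (i < j)%N.
Proof. by rewrite !ltnNge leq_bump2. Qed.

Lemma insert_max_at (n : nat) (t : 'I_n.+1) (pi : 'S_n) :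
  insert_max t pi t = ord_max.
Proof. exact: lift_perm_id. Qed.

Lemma insert_max_lift (n : nat) (t : 'I_n.+1) (pi : 'S_n) (i : 'I_n) :
  insert_max t pi (lift t i) = pi i :> nat.
Proof. by rewrite lift_perm_lift lift_max. Qed.

Lemma box12_occ_max_l (n : nat) (t j : 'I_n.+1) (pi : 'S_n) :
  box12_occ (insert_max t pi) t j = false.
Proof.
by rewrite /box12_occ insert_max_at [(ord_max < _)%N]ltnNge leq_ord andbF.
Qed.

Lemma box12_occ_lift_lift (n : nat) (t : 'I_n.+1) (pi : 'S_n) (i j : 'I_n) :
  box12_occ (insert_max t pi) (lift t i) (lift t j) = box12_occ pi i j.
Proof.
rewrite /box12_occ ltn_lift !insert_max_lift; congr [&& _, _ & ~~ _].
apply/existsP/existsP => [[k]|[k Hk]]; last first.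
  by exists (lift t k); rewrite !ltn_lift insert_max_lift.
case: (unliftP t k) => [k' ->|->].
  by rewrite !ltn_lift insert_max_lift; exists k'.
by rewrite insert_max_at => /and3P[_ _]; rewrite ltnNge (ltnW (ltn_ord _)).
Qed.

Lemma ltn_lift_max (n : nat) (t : 'I_n.+1) (i : 'I_n) :
  (lift t i < t)%N = (i < t)%N.
Proof.
by rewrite /= /bump; case: (leqP t i) => // ti; rewrite ltnNge leqW.
Qed.

(** The comparison [pi j < pi i] is the negation of [pi i < pi j] because
    [i < j] forces [pi i] and [pi j] to differ. *)
Lemma box12_occ_lift_max (n : nat) (t : 'I_n.+1) (pi : 'S_n) (i : 'I_n) :
  box12_occ (insert_max t pi) (lift t i) t =
  (i < t)%N && [forall j : 'I_n, (i < j < t)%N ==> (pi j < pi i)%N].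
Proof.
rewrite /box12_occ ltn_lift_max insert_max_at insert_max_lift ltn_ord /=.
congr (_ && _); rewrite negb_exists; apply/forallP/forallP => H j.
- have := H (lift t j); rewrite ltn_lift ltn_lift_max insert_max_lift ltn_ord.
  rewrite andbT; case: (boolP (i < j < t)%N) => //= /andP[ij _].
  rewrite -leqNgt leq_eqVlt => /orP[/eqP /val_inj /perm_inj e|//].
  by rewrite e ltnn in ij.
- case: (unliftP t j) => [k ->|->]; last by rewrite ltnn andbF.
  rewrite ltn_lift ltn_lift_max insert_max_lift.
  by have := H k; case: (_ < k < _)%N => //= ki; rewrite [(pi i < _)%N]ltnNge ltnW.
Qed.

(** Summing over all positions of [pi], rather than those of the prefix, makes
    this agree term by term with [box12_occ_lift_max]. *)
Lemma rlmax_take_word (n : nat) (t : 'I_n.+1) (pi : 'S_n) :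
  rlmax (take t (word pi)) =
  (\sum_(i < n) ((i < t) && [forall j : 'I_n, (i < j < t) ==> (pi j < pi i)]))%N.
Proof.
have tn : (t <= n)%N by rewrite -ltnS.
have st : size (take t (word pi)) = t by rewrite size_takel // size_word.
rewrite /rlmax st -sum1dep_card big_mkcond /=.
pose F i : nat := [forall j : 'I_t,
  (i < j)%N ==> (nth 0 (take t (word pi)) j < nth 0 (take t (word pi)) i)%N].
rewrite (eq_bigr (fun i : 'I_t => F i)); last first.
  by move=> i _; rewrite /F; case: [forall _, _].
rewrite (big_ord_widen _ F tn) big_mkcond /=; apply: eq_bigr => i _.
case: (boolP (i < t)%N) => //= it; congr nat_of_bool.
apply/forallP/forallP => H j.
- apply/implyP => /andP[ij jt]; have /implyP := H (Ordinal jt).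
  by move=> /(_ ij); rewrite !nth_take // !nth_word.
- apply/implyP => ij; rewrite !nth_take //.
  have /implyP := H (widen_ord tn j); rewrite /= ij ltn_ord => /(_ isT).
  by rewrite -[nat_of_ord j]/(nat_of_ord (widen_ord tn j)) !nth_word ltnS.
Qed.

Lemma b_insert_max (n : nat) (pi : 'S_n) (t : 'I_n.+1) :
  b (insert_max t pi) = (b pi + rlmax (take t (word pi)))%N.
Proof.
rewrite !b_sum rlmax_take_word (bigD1_ord t) //= big1 ?add0n => [|j _]; last first.
  by rewrite box12_occ_max_l.
rewrite -big_split; apply: eq_bigr => i _ /=.
rewrite (bigD1_ord t) //= box12_occ_lift_max addnC; congr (_ + _)%N.
by apply: eq_bigr => j _; rewrite box12_occ_lift_lift.
Qed.

(** The position [t] is recovered as the preimage of [ord_max], and [pi] as what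
    is left; surjectivity then follows by counting, as [n.+1`! = n.+1 * n`!]. *)
Lemma insert_max_bij (n : nat) :
  bijective (fun p : 'S_n * 'I_n.+1 => insert_max p.2 p.1).
Proof.
apply: inj_card_bij => [[pi t] [pi' t'] /= e|]; last first.
  by rewrite card_prod card_ord !card_Sn factS mulnC.
have et : t = t'.
  by apply: (@perm_inj _ (insert_max t pi)); rewrite {2}e !insert_max_at.
subst t'; congr pair; apply/permP => i; apply: val_inj => /=.
by rewrite -(insert_max_lift _ t pi) e insert_max_lift.
Qed.

Theorem proposition8p7 (n : nat) :
  (forall (pi : 'S_n) (t : 'I_n.+1),
     b (insert_max t pi) = (b pi + rlmax (take t (word pi)))%N)
  /\ D n.+1 = \sum_(pi : 'S_n)
                'X^(b pi) * (\sum_(t < n.+1) 'X^(rlmax (take t (word pi)))).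
Proof.
split; first exact: b_insert_max.
rewrite /D (reindex _ (onW_bij _ (insert_max_bij n))) /=.
rewrite -(pair_bigA _ (fun pi t => 'X^(b (insert_max t pi)))) /=.
apply: eq_bigr => pi _; rewrite big_distrr; apply: eq_bigr => t _ /=.
by rewrite b_insert_max exprD.
Qed.
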